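(* For every non-monotone pattern $\sigma\in S_m\setminus\{(1\,2\,\dots\,m),(m\,\dots\,2\,1)\}$, $$\rho_{\sigma}\leq 1-\frac{1}{m!}+O\left(\frac{1}{m^2\, m!}\right),$$ where the $O$-term refers to $m\to\infty$ and is uniform in $\sigma$: there are constants $C>0$ and $m_0$ such that for all $m\ge m_0$ and all non-monotone $\sigma\in S_m$, $\rho_\sigma\le 1-\frac{1}{m!}+\frac{C}{m^2\,m!}$.
   Context: $S_n$ denotes the set of permutations of $\{1,\dots,n\}$, written $\pi=(\pi_1,\dots,\pi_n)$. For a sequence $(x_1,\dots,x_k)$ of distinct integers, its standardization $\mathrm{st}(x_1,\dots,x_k)\in S_k$ is obtained by replacing each entry by its rank among $x_1,\dots,x_k$. A permutation $\pi\in S_n$ contains $\sigma\in S_m$ as a consecutive pattern if $\mathrm{st}(\pi_{i+1},\dots,\pi_{i+m})=\sigma$ for some $0\le i\le n-m$; otherwise $\pi$ is $\sigma$-avoiding. Let $\alpha_n(\sigma)$ be the number of $\sigma$-avoiding permutations in $S_n$, and $\rho_\sigma=\lim_{n\to\infty}(\alpha_n(\sigma)/n!)^{1/n}$ (this limit is known to exist). The monotone patterns of length $m$ are $(1\,2\,\dots\,m)$ and $(m\,\dots\,2\,1)$. *)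

(* Defs.v *)
From HB Require Import structures.
From mathcomp Require Import all_boot all_order all_algebra all_fingroup.
From mathcomp Require Import all_classical all_reals all_analysis.

Set Implicit Arguments.
Unset Strict Implicit.
Unset Printing Implicit Defensive.

Import Order.TTheory GRing.Theory Num.Theory.
Import numFieldNormedType.Exports.

Local Open Scope ring_scope.

(* Elements of 'S_n permute {0, ..., n-1}; the shift by one gives the usual
   one-line notation with entries in {1, ..., n}. *)
Definition one_line (n : nat) (p : 'S_n) : seq nat :=
  [seq (p i : nat).+1 | i <- enum 'I_n].

(* Ranks are counted from 1.  For distinct entries, the result is the
   one-line notation of a permutation of {1, ..., size x}. *)
Definition st (x : seq nat) : seq nat :=
  [seq count (fun z => (z <= y)%N) x | y <- x].

Definition contains (m n : nat) (s : 'S_m) (p : 'S_n) : bool :=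
  [exists i : 'I_n.+1,
    (i + m <= n)%N && (st (take m (drop i (one_line p))) == one_line s)].

Definition alpha (m : nat) (s : 'S_m) (n : nat) : nat :=
  #|[set p : 'S_n | ~~ contains s p]%SET|.

(* [limn] returns a default value on divergent sequences, but this limit is
   known to exist for every pattern.  The term n = 0 is junk. *)
Definition rho (R : realType) (m : nat) (s : 'S_m) : R :=
  limn (fun n : nat => ((alpha s n)%:R / n`!%:R : R) `^ (n%:R^-1)).

Definition incr_pattern (m : nat) : 'S_m := 1%g.

Definition decr_pattern (m : nat) : 'S_m := perm (@rev_ord_inj m).

(* Main.v *)
(* Let a_n = alpha_n(s) / n! be the probability that a uniform permutation of
   size n avoids s.  The pattern formed by a block is uniform and independent of
   what precedes the block, so sieving on an occurrence in the last m positions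
   gives
     a_{n-1} - a_{n-m} / m! <= a_n
       <= a_{n-1} - a_{n-m} / m! + sum_(0 < k < m) p_k a_{n-m-k},
   where p_k is the probability that a permutation of size m + k both starts and
   ends with an occurrence of s.  The lower bound implies a_{n-2m} <= 2 a_n, and
   then the upper one gives a_n <= (1 - 1/m! + 2 sum_k p_k) a_{n-1}.
   A permutation counted by p_k is determined by the way its first k and its last
   k values are shuffled, so p_k <= 4^k / (m + k)!; moreover p_1 = 0 unless s is
   monotone.  Hence the sum of the p_k is O(1 / (m^2 m!)). *)

Require Import Defs.
From HB Require Import structures.
From mathcomp Require Import all_boot all_order all_algebra all_fingroup.
From mathcomp Require Import all_classical all_reals all_analysis.
From mathcomp Require Import zify ring lra.

Set Implicit Arguments.
Unset Strict Implicit.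
Unset Printing Implicit Defensive.

Import Order.TTheory GRing.Theory Num.Theory.
Import numFieldNormedType.Exports.

Local Open Scope ring_scope.
Local Open Scope nat_scope.

(** * Words, occurrences and avoidance on prefixes *)

(** A total function of the position, so that shifted positions carry no bound proofs; outside the
    permutation its value is the default 0. *)
Definition word (n : nat) (p : 'S_n) (i : nat) : nat := nth 0%N (one_line p) i.

Definition occ (m : nat) (s : 'S_m) (w : nat -> nat) (i : nat) : bool :=
  [forall a : 'I_m, forall b : 'I_m,
    ((s a < s b)%N == (w (i + a) < w (i + b))%N)].

(** Only the first [N] entries of [w] are tested, so one permutation can be examined on all its
    prefixes. *)
Definition avoid (m : nat) (s : 'S_m) (w : nat -> nat) (N : nat) : bool :=
  [forall i : 'I_N.+1, (i + m <= N)%N ==> ~~ occ s w i].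

Lemma wordE (n : nat) (p : 'S_n) (i : 'I_n) : word p i = (p i).+1.
Proof.
rewrite /word /one_line (nth_map i) ?size_enum_ord //.
by rewrite nth_ord_enum.
Qed.

Lemma word_inj (n : nat) (p : 'S_n) (i j : nat) :
  i < n -> j < n -> word p i = word p j -> i = j.
Proof.
move=> hi hj; rewrite -[i]/(val (Ordinal hi)) -[j]/(val (Ordinal hj)) !wordE.
by move=> [] /val_inj /perm_inj ->.
Qed.

Lemma occP (m : nat) (s : 'S_m) (w : nat -> nat) (i : nat) :
  reflect (forall a b : 'I_m, (s a < s b) = (w (i + a) < w (i + b)))
          (occ s w i).
Proof.
apply: (iffP forallP) => [h a b|h a]; first by move/forallP: (h a) => /(_ b)/eqP.
by apply/forallP => b; rewrite h.
Qed.

Lemma avoidP (m : nat) (s : 'S_m) (w : nat -> nat) (N : nat) :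
  reflect (forall i, i + m <= N -> ~~ occ s w i) (avoid s w N).
Proof.
apply: (iffP forallP) => [h i hi|h i]; last by apply/implyP; exact: h.
have hiN : i < N.+1 by lia.
by move: (h (Ordinal hiN)) => /implyP; apply.
Qed.

(** * Ranks, order isomorphism and standardization *)

Lemma rank_perm (m : nat) (s : 'S_m) (a : 'I_m) :
  \sum_(b < m) (s b < s a) = s a.
Proof.
have <- : \sum_(c < m) (c < s a) = \sum_(b < m) (s b < s a).
  exact: (reindex_inj (@perm_inj _ s)).
rewrite -big_mkcondr /= -[RHS](card_ord (s a)) -sum1_card.
by rewrite (big_ord_widen m (fun=> 1)) // ltnW.
Qed.

Lemma pattern_unique (m : nat) (s t : 'S_m) :
  (forall a b, (s a < s b) = (t a < t b)) -> s = t.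
Proof.
move=> h; apply/permP => a; apply: val_inj.
by rewrite /= -(rank_perm s) -(rank_perm t); apply: eq_bigr => b _; rewrite h.
Qed.

(** Counts below a threshold grow with it, and strictly when it passes [g i], because [g i] itself
    is then counted. *)
Lemma rank_lt (k : nat) (g : 'I_k -> nat) (i : 'I_k) (v : nat) :
  (g i < v) = (\sum_(j < k) (g j < g i) < \sum_(j < k) (g j < v)).
Proof.
case: ltnP => hv.
  rewrite (bigD1 i) //= [X in _ < X](bigD1 i) //= ltnn hv add0n add1n ltnS.
  by apply/esym/leq_sum => j _; case: ltnP => // hj; rewrite (ltn_trans hj hv).
apply/esym/negbTE; rewrite -leqNgt; apply: leq_sum => j _.
by case: ltnP => // hj; rewrite (leq_trans hj hv).
Qed.

Lemma pattern_exists (m : nat) (g : 'I_m -> nat) :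
  injective g -> exists s : 'S_m, forall a b, (s a < s b) = (g a < g b).
Proof.
move=> ginj.
pose r a := \sum_(b < m) (g b < g a).
have rlt a : r a < m.
  rewrite -[X in _ < X]card_ord -sum1_card /r [X in _ < X](bigD1 a) //=.
  rewrite (bigD1 a) //= ltnn add0n add1n ltnS.
  by apply: leq_sum => b _; case: (_ < _).
have rE a b : (r a < r b) = (g a < g b) by rewrite [RHS]rank_lt.
have rinj : injective (fun a => Ordinal (rlt a)).
  move=> a b [] hab; apply: ginj.
  by case: (ltngtP (g a) (g b)) => //; rewrite -rE hab ltnn.
by exists (perm rinj) => a b; rewrite !permE /= rE.
Qed.

(** Bridge between the literal definition through [st] and the order comparisons used from here
    on. *)
Lemma st_pattern (m : nat) (s : 'S_m) (g : nat -> nat) :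
  reflect (forall a b : 'I_m, (s a < s b) = (g a < g b))
          (st (mkseq g m) == one_line s).
Proof.
have cE y : count (fun z => z <= y) (mkseq g m) = \sum_(b < m) (g b <= y).
  rewrite /mkseq count_map -sum1_count big_mkcond /= -[m in iota _ m]subn0.
  by rewrite big_mkord; apply: eq_bigr => b _; case: (_ <= _).
have -> : st (mkseq g m) = [seq \sum_(b < m) (g b <= g a) | a : 'I_m <- enum 'I_m].
  rewrite /st (eq_map cE) /mkseq -val_enum_ord -!map_comp.
  exact: eq_map.
rewrite /one_line; apply: (iffP eqP).
  move=> /eq_in_map h.
  have hS (a : 'I_m) : \sum_(b < m) (g b <= g a) = (s a).+1 by apply: h; rewrite mem_enum.
  have mono (a b : 'I_m) : s a < s b -> g a < g b.
    rewrite -ltnS -!hS => hab; rewrite ltnNge; apply/negP => hba.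
    move: hab; rewrite ltnNge => /negP; apply; apply: leq_sum => c _.
    by case: (leqP (g c) (g b)) => // hc; rewrite (leq_trans hc hba).
  move=> a b; apply/idP/idP; first exact: mono.
  case: (ltngtP (s a) (s b)) => // [/mono|/val_inj/perm_inj ->]; lia.
move=> h; apply: eq_map => a.
(* [st] counts non-strictly: the term [b == a] is the entry itself and accounts for the shift by one
   in [one_line]. *)
rewrite (eq_bigr (fun b : 'I_m => (b == a) + nat_of_bool (s b < s a))); last first.
  move=> b _; rewrite leqNgt -h -leqNgt leq_eqVlt (inj_eq val_inj) (inj_eq perm_inj).
  by case: eqP => [->|]; rewrite ?ltnn.
rewrite big_split /= rank_perm -big_mkcond /=.
by rewrite big_pred1_eq.
Qed.

Lemma containsE (m n : nat) (s : 'S_m) (p : 'S_n) :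
  ~~ contains s p = avoid s (word p) n.
Proof.
rewrite /contains /avoid negb_exists; apply: eq_forallb => i.
case: (leqP (i + m) n) => //= him; congr (~~ _).
have le_m : m <= size (drop i (one_line p)).
  by rewrite size_drop size_map size_enum_ord; lia.
have -> : take m (drop i (one_line p)) = mkseq (fun a => word p (i + a)) m.
  apply: (@eq_from_nth _ 0); rewrite size_takel ?size_mkseq // => j hj.
  by rewrite nth_take // nth_drop nth_mkseq.
by apply/st_pattern/occP.
Qed.

(** * Uniformity of block patterns and independence from the prefix *)

(** Composing with [G] rearranges a block of positions and keeps everything before it, which turns
    one block pattern into another. *)
Lemma extend_perm (n m off : nat) (g : 'S_m) : off + m <= n ->
  exists G : 'S_n, (forall x : 'I_n, x < off -> G x = x) /\
    (forall (a : 'I_m) (x : 'I_n), x = off + a :> nat -> G x = off + g a :> nat).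
Proof.
move=> le_n.
pose f x := if off <= x then if insub (x - off) is Some a then off + g a else x
            else x.
have fP x : (x < off \/ off + m <= x) /\ f x = x \/
    exists a : 'I_m, x = off + a /\ f x = off + g a.
  rewrite /f; case: (leqP off x) => hx; last by left; split=> //; left.
  case: insubP => [a _ ea|]; first by right; exists a; split=> //; rewrite ea; lia.
  by rewrite -leqNgt => hm; left; split=> //; right; lia.
have f_lt (x : 'I_n) : f x < n.
  case: (fP x) => [[_ ->]|[a [_ ->]]] //.
  by have := ltn_ord (g a); lia.
have finj : injective (fun x : 'I_n => Ordinal (f_lt x)).
  move=> x y [] exy; apply: val_inj => /=; move: exy.
  case: (fP x) (fP y) => [[hx ->]|[a [-> ->]]] [[hy ->]|[b [-> ->]]] //.
  - by have := ltn_ord (g b); lia.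
  - by have := ltn_ord (g a); lia.
  - by move/addnI/val_inj/perm_inj ->.
exists (perm finj); split=> [x hx|a x hx].
  apply: val_inj; rewrite permE /=.
  by case: (fP x) => [[_ ->]|[a [ha _]]] //; lia.
rewrite permE /=; case: (fP x) => [[h _]|[b [hb ->]]].
  by have := ltn_ord a; lia.
by have -> : a = b by apply: val_inj => /=; lia.
Qed.

Lemma sum_occ (n m off : nat) (p : 'S_n) : off + m <= n ->
  \sum_(t : 'S_m) occ t (word p) off = 1.
Proof.
move=> le_n.
have [a b|t ht] := @pattern_exists m (fun a => word p (off + a)).
  move/word_inj => h; apply: val_inj; apply: (@addnI off).
  by apply: h; have := ltn_ord a; have := ltn_ord b; lia.
rewrite (bigD1 t) //= (introT (occP _ _ _)) // big1 // => u /negP ut.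
case: occP => // hu; case: ut; apply/eqP/pattern_unique => a b.
by rewrite hu ht.
Qed.

Lemma card_andE (T : finType) (P Q : pred T) :
  #|[set x | Q x && P x]%SET| = \sum_(x | Q x) P x.
Proof. by rewrite cardsE -sum1_card big_mkcondr; apply: eq_bigr. Qed.

Definition prefix_only (n off : nat) (Q : pred 'S_n) :=
  forall p q : 'S_n, (forall i, i < off -> word p i = word q i) -> Q p = Q q.

(** Rearranging the block by [v * u^-1] injects the permutations with block pattern [u] into those
    with pattern [v] and preserves [Q]. Hence all block patterns are equally frequent. *)
Lemma card_prefix_occ (n m off : nat) (t : 'S_m) (Q : pred 'S_n) :
  off + m <= n -> prefix_only off Q ->
  #|[set p | Q p && occ t (word p) off]%SET| * m`! = #|[set p | Q p]%SET|.
Proof.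
move=> le_n prefQ; pose X (t : 'S_m) := [set p | Q p && occ t (word p) off]%SET.
have leX u v : #|X u| <= #|X v|.
  have [G [Glt Gblk]] := extend_perm (v * u^-1)%g le_n.
  rewrite -(card_imset (mem (X u)) (@mulgI _ G)); apply/subset_leq_card/fintype.subsetP.
  move=> _ /imsetP[p pX ->]; move: pX; rewrite !inE => /andP[Qp /occP up].
  have wG (x : 'I_n) : word (G * p)%g x = word p (G x).
    by rewrite !wordE permM.
  apply/andP; split.
    rewrite -(prefQ p) // => i hi; have hin : i < n by lia.
    by rewrite -[i]/(val (Ordinal hin)) wG Glt.
  have wB (a : 'I_m) : word (G * p)%g (off + a) = word p (off + (v * u^-1)%g a).
    have ha : off + a < n by have := ltn_ord a; lia.
    by rewrite -[off + a]/(val (Ordinal ha)) wG (Gblk a).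
  by apply/occP => a b; rewrite !wB -up -!permM mulgKV.
rewrite [in RHS]cardsE -[in RHS]sum1_card.
rewrite (eq_bigr (fun p => \sum_(u : 'S_m) occ u (word p) off)); last first.
  by move=> p _; rewrite sum_occ.
rewrite exchange_big /= (eq_bigr (fun=> #|X t|)).
  by rewrite sum_nat_const card_Sn mulnC.
move=> u _; rewrite -card_andE; apply/eqP.
by rewrite eqn_leq !leX.
Qed.

Lemma occ_equiv (m : nat) (s : 'S_m) (w v : nat -> nat) (i j : nat) :
  (forall a b : 'I_m, (w (i + a) < w (i + b)) = (v (j + a) < v (j + b))) ->
  occ s w i = occ s v j.
Proof.
by move=> h; apply: eq_forallb => a; apply: eq_forallb => b; rewrite h.
Qed.

Lemma occ_sub (m n M off i : nat) (s : 'S_m) (t : 'S_M) (p : 'S_n) :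
  occ t (word p) off -> i + m <= M ->
  occ s (word p) (off + i) = occ s (word t) i.
Proof.
move=> /occP h le_M; apply: occ_equiv => a b.
have ha : i + a < M by have := ltn_ord a; lia.
have hb : i + b < M by have := ltn_ord b; lia.
rewrite -!addnA -(h (Ordinal ha) (Ordinal hb)).
by rewrite -[i + a]/(val (Ordinal ha)) -[i + b]/(val (Ordinal hb)) !wordE ltnS.
Qed.

Lemma eq_avoid (m : nat) (s : 'S_m) (w v : nat -> nat) (N : nat) :
  (forall i, i + m <= N -> occ s w i = occ s v i) ->
  avoid s w N = avoid s v N.
Proof.
by move=> h; apply/avoidP/avoidP => hw i hi; move: (hw i hi); rewrite h.
Qed.

Lemma avoid_prefix_only (m n N : nat) (s : 'S_m) :
  prefix_only N (fun p : 'S_n => avoid s (word p) N).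
Proof.
move=> p q pq; apply: eq_avoid => i hi; apply: occ_equiv => a b.
by rewrite !pq //; have := ltn_ord a; have := ltn_ord b; lia.
Qed.

(** Independence of the block from its prefix: [card_prefix_occ] is summed over the patterns [t]
    that satisfy [F]. *)
Lemma card_prefix_pattern (n M off : nat) (Q E : pred 'S_n) (F : pred 'S_M) :
  off + M <= n -> prefix_only off Q ->
  (forall (p : 'S_n) (t : 'S_M), occ t (word p) off -> E p = F t) ->
  #|[set p | Q p && E p]%SET| * M`! = #|[set p | Q p]%SET| * #|[set t | F t]%SET|.
Proof.
move=> le_n prefQ EF.
rewrite [in LHS]cardsE -[in LHS]sum1_card.
rewrite (eq_bigr (fun p => \sum_(t : 'S_M) occ t (word p) off)); last first.
  by move=> p _; rewrite sum_occ.
rewrite exchange_big /= big_distrl /=.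
rewrite [in X in _ = _ * X]cardsE -[in X in _ = _ * X]sum1_card big_distrr /=.
rewrite [RHS]big_mkcond; apply: eq_bigr => t _.
rewrite muln1 -[t \in _]/(F t); case Ft: (F t).
  rewrite -(card_prefix_occ t le_n prefQ) card_andE; congr (_ * _).
  rewrite big_mkcondr; apply: eq_bigr => p _.
  by case o: (occ _ _ _); [rewrite (EF _ _ o) Ft|case: (E p)].
rewrite big1 // => p /andP[_ Ep].
by case o: (occ _ _ _) => //; rewrite -(EF _ _ o) Ep in Ft.
Qed.

(** Case of an empty prefix: the block formed by the first [N] entries has a uniform pattern. *)
Lemma card_avoid (m n N : nat) (s : 'S_m) : N <= n ->
  #|[set p : 'S_n | avoid s (word p) N]%SET| * N`! = n`! * alpha s N.
Proof.
move=> le_n.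
have := @card_prefix_pattern n N 0 predT (fun p => avoid s (word p) N)
  (fun t => avoid s (word t) N).
rewrite cardsT card_Sn /alpha => -> //.
  by congr (_ * _); apply: eq_card => t; rewrite !inE containsE.
by move=> p t o; apply: eq_avoid => i hi; rewrite -(occ_sub s o) // add0n.
Qed.

(** * Counting permutations with two overlapping occurrences *)

(** An element of a finite set is determined by its rank there. Both maps have the same image, and
    equal comparisons give [g i] and [h i] the same rank in it. *)
Lemma eq_image_mono (k N : nat) (g h : 'I_k -> 'I_N) :
  (forall i j, (g i < g j) = (h i < h j)) -> injective g ->
  [set g i | i : 'I_k]%SET = [set h i | i : 'I_k]%SET -> g =1 h.
Proof.
move=> gh ginj eqim.
have hinj : injective h.
  move=> i j e; apply: ginj; apply: val_inj => /=.
  by case: (ltngtP (g i) (g j)) => //; rewrite gh e ltnn.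
have cnt (v : nat) : \sum_i (g i < v) = \sum_i (h i < v).
  have := erefl (\sum_(x in [set g i | i : 'I_k]%SET) (x < v)).
  by rewrite [in RHS]eqim !big_imset //=; apply: in2W.
move=> j; have /imsetP[i _ hji] : h j \in [set g i | i : 'I_k]%SET.
  by rewrite eqim imset_f.
have rk : \sum_l (g l < g i) = \sum_l (g l < g j).
  by rewrite -hji cnt; apply: eq_bigr => l _; rewrite gh.
rewrite hji; apply: val_inj => /=.
have := rank_lt (fun l => val (g l)) i (g j).
have := rank_lt (fun l => val (g l)) j (g i).
by rewrite /= rk !ltnn; case: ltngtP.
Qed.

Definition overlaps (m : nat) (s : 'S_m) (k : nat) : {set 'S_(m + k)} :=
  [set t | occ s (word t) 0 && occ s (word t) k]%SET.

(** The occurrences at 0 and [k] fix every comparison except those between the first [k] and the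
    last [k] positions. These are encoded by a subset of [2 * k] ranks, which leaves at most
    [2 ^ (2 * k)] cases. *)
Lemma card_overlaps (m k : nat) (s : 'S_m) : k <= m -> #|overlaps s k| <= 4 ^ k.
Proof.
move=> le_km.
pose r (t : 'S_(m + k)) (j : 'I_k) := \sum_(l < k) (word t (m + l) < word t (m + j)).
pose c (t : 'S_(m + k)) (j : 'I_k) := \sum_(l < k) (word t l < word t (m + j)).
have r_lt t j : r t j < k.
  rewrite /r -[X in _ < X]card_ord -sum1_card (bigD1 j) //= ltnn.
  rewrite [X in _ < X](bigD1 j) //= add0n add1n ltnS.
  by apply: leq_sum => l _; case: (_ < _).
have c_le t j : c t j <= k.
  rewrite /c -[X in _ <= X]card_ord -sum1_card.
  by apply: leq_sum => l _; case: (_ < _).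
have g_lt t j : c t j + r t j < k + k by have := r_lt t j; have := c_le t j; lia.
pose g t j := Ordinal (g_lt t j).
have g_mono t (i j : 'I_k) : word t (m + i) < word t (m + j) -> g t i < g t j.
  move=> hij; rewrite /= -addnS; apply: leq_add; last first.
    by rewrite -(rank_lt (fun l : 'I_k => word t (m + l))).
  by apply: leq_sum => l _; case: ltnP => // hl; rewrite (ltn_trans hl hij).
have gE t (i j : 'I_k) : (g t i < g t j) = (word t (m + i) < word t (m + j)).
  apply/idP/idP; last exact: g_mono.
  case: (ltngtP (word t (m + i)) (word t (m + j))) => //.
    by move/g_mono; lia.
  move/word_inj => e; have /val_inj -> : i = j :> nat; last by rewrite ltnn.
  by apply: (@addnI m); apply: e; rewrite ltn_add2l.
have g_inj t : injective (g t).
  move=> i j e; apply: val_inj; apply: (@addnI m); apply: (@word_inj _ t).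
  - by rewrite /= ltn_add2l.
  - by rewrite /= ltn_add2l.
  have := gE t i j; have := gE t j i; rewrite e ltnn.
  by case: (ltngtP (word t (m + i)) (word t (m + j))).
(* The ranks of the last [k] values of [t] among its first [k] and last [k]
   values. *)
pose code t := [set g t j | j : 'I_k]%SET.
have code_inj : {in overlaps s k &, injective code}.
  move=> t u; rewrite !inE => /andP[/occP t0 /occP tk] /andP[/occP u0 /occP uk] e.
  have low x y : x < m -> y < m ->
      (word t x < word t y) = (word u x < word u y).
    by move=> hx hy; rewrite -(t0 (Ordinal hx) (Ordinal hy)) u0.
  have high x y : k <= x < m + k -> k <= y < m + k ->
      (word t x < word t y) = (word u x < word u y).
    move=> hx hy; have hx' : x - k < m by lia.
    have hy' : y - k < m by lia.
    move: (tk (Ordinal hx') (Ordinal hy')); rewrite uk /=.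
    by rewrite !subnKC //; lia.
  (* [r] only compares positions of the second occurrence, so it is the same for [t] and [u]; equal
     codes give equal [g], and subtraction gives equal [c]. *)
  have eqr j : r t j = r u j.
    apply: eq_bigr => l _; rewrite high //; have := ltn_ord l; have := ltn_ord j; lia.
  have eqg : g t =1 g u.
    apply: eq_image_mono => // i j; rewrite !gE high //;
      have := ltn_ord i; have := ltn_ord j; lia.
  have eqc j : c t j = c u j by move: (congr1 val (eqg j)); rewrite /= eqr => /addIn.
  have cross x y : x < k -> m <= y < m + k ->
      (word t x < word t y) = (word u x < word u y).
    move=> hx hy; have hy' : y - m < k by lia.
    have ey : y = m + Ordinal hy' by rewrite /= subnKC; lia.
    (* An early value lies below a late one exactly when its rank among the first [k] values is
       below [c], and that rank is read inside the first occurrence. *)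
    have rl v := rank_lt (fun l : 'I_k => word v l) (Ordinal hx) (word v y).
    rewrite !rl /= ey -![\sum_(_ < _) (_ < word _ (m + _))]/(c _ _) eqc.
    congr (_ < _); apply: eq_bigr => l _; rewrite low //; have := ltn_ord l; lia.
  apply: pattern_unique => x y.
  suff : (word t x < word t y) = (word u x < word u y) by rewrite !wordE.
  have hx := ltn_ord x; have hy := ltn_ord y.
  case: (ltnP x m) (ltnP y m) => [xm|xm] [ym|ym]; first exact: low.
  - by case: (ltnP x k) => xk; [apply: cross|apply: high]; lia.
  - case: (ltnP y k) => yk; last by apply: high; lia.
    have neq (v : 'S_(m + k)) : (word v x < word v y) = ~~ (word v y < word v x).
      by case: ltngtP => // /word_inj exy; have := exy hx hy; lia.
    by rewrite !neq cross //; lia.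
  - by apply: high; lia.
rewrite -(card_in_imset code_inj) (leq_trans (max_card _)) //.
by rewrite -cardsT -powersetT card_powerset cardsT card_ord -[4]/(2 ^ 2) -expnM
  mul2n addnn.
Qed.

(** With shift 1, each adjacent comparison equals the next one, so the word is monotone on all
    [m + 1] positions, and therefore so is [s]. *)
Lemma overlaps1 (m : nat) (s : 'S_m) :
  s \notin [set incr_pattern m; decr_pattern m]%SET -> #|overlaps s 1| = 0.
Proof.
move=> nmono; apply/eqP; rewrite cards_eq0; apply: contraNT nmono => /set0Pn[t].
rewrite !inE => /andP[/occP t0 /occP t1]; set w := word t in t0 t1.
have neq i : i < m -> w i != w i.+1.
  by move=> hi; apply/eqP => /word_inj; lia.
have dir i : i < m -> (w i < w i.+1) = (w 0 < w 1).
  elim: i => // i IH hi; have hi' : i < m by lia.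
  by rewrite -IH // -(t1 (Ordinal hi') (Ordinal hi)) (t0 (Ordinal hi') (Ordinal hi)).
have [up|down] := boolP (w 0 < w 1).
  have mono i j : i < j -> j <= m -> w i < w j.
    elim: j => // j IH; rewrite ltnS leq_eqVlt => /orP[/eqP ->|hij] hj.
      by rewrite dir.
    by apply: (ltn_trans (IH hij (ltnW hj))); rewrite dir.
  apply/orP; left; apply/eqP/pattern_unique => a b; rewrite t0 !perm1 !add0n.
  have ha := ltn_ord a; have hb := ltn_ord b.
  case: (ltngtP a b) => [h|h|/val_inj ->]; rewrite ?ltnn //.
    by rewrite mono //; lia.
  by have := mono _ _ h; lia.
have mono i j : i < j -> j <= m -> w j < w i.
  have step l : l < m -> w l.+1 < w l.
    by move=> hl; have := neq _ hl; have := dir _ hl; rewrite (negbTE down); lia.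
  elim: j => // j IH; rewrite ltnS leq_eqVlt => /orP[/eqP ->|hij] hj.
    exact: step.
  by apply: (ltn_trans _ (IH hij (ltnW hj))); apply: step.
apply/orP; right; apply/eqP/pattern_unique => a b; rewrite t0 !permE /= !add0n.
have ha := ltn_ord a; have hb := ltn_ord b.
case: (ltngtP a b) => [h|h|/val_inj ->]; last by rewrite !ltnn.
  by have := mono _ _ h; lia.
by rewrite mono //; lia.
Qed.

(** * Sieving on an occurrence at the end of a prefix *)

Lemma avoidS (m : nat) (s : 'S_m) (w : nat -> nat) (N : nat) : m <= N.+1 ->
  avoid s w N.+1 = avoid s w N && ~~ occ s w (N.+1 - m).
Proof.
move=> le_m; apply/avoidP/andP => [h|[/avoidP h o] i].
  by split; [apply/avoidP => i hi|]; apply: h; lia.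
rewrite leq_eqVlt => /orP[/eqP e|hi]; last by apply: h; lia.
by have -> : i = N.+1 - m by lia.
Qed.

Lemma leq_avoid (m : nat) (s : 'S_m) (w : nat -> nat) (M N : nat) :
  M <= N -> avoid s w N -> avoid s w M.
Proof. by move=> le_MN /avoidP h; apply/avoidP => i hi; apply: h; lia. Qed.

Lemma card_avoidS (m n N : nat) (s : 'S_m) : m <= N.+1 ->
  #|[set p : 'S_n | avoid s (word p) N]%SET| =
  #|[set p : 'S_n | avoid s (word p) N.+1]%SET| +
  #|[set p : 'S_n | avoid s (word p) N && occ s (word p) (N.+1 - m)]%SET|.
Proof.
move=> le_m; rewrite -(cardsID [set p : 'S_n | occ s (word p) (N.+1 - m)]%SET) addnC.
congr (_ + _); apply: eq_card => p; rewrite !inE // avoidS // andbC.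
by rewrite andbC.
Qed.

Lemma sum_card (T : finType) (P : pred T) : #|[set x | P x]%SET| = \sum_x P x.
Proof. by rewrite cardsE -sum1_card big_mkcond; apply: eq_bigr. Qed.

(** Union bound. An occurrence that spoils avoidance up to [N] starts before [d] and reaches past
    the first [d] entries, so it is shifted by some [0 < k < m]. Avoidance is then relaxed to the
    [d - k] entries preceding both blocks, where independence applies. *)
Lemma card_avoid_occ_le (m n N d : nat) (s : 'S_m) : N.+1 = d + m -> m <= d ->
  #|[set p : 'S_n | avoid s (word p) d && occ s (word p) d]%SET| <=
  #|[set p : 'S_n | avoid s (word p) N && occ s (word p) d]%SET| +
  \sum_(1 <= k < m) #|[set p : 'S_n | avoid s (word p) (d - k) &&
                        (occ s (word p) (d - k) && occ s (word p) d)]%SET|.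
Proof.
move=> eN le_md.
under [X in _ <= _ + X]eq_bigr do rewrite sum_card.
rewrite !sum_card exchange_big -big_split /=; apply: leq_sum => p _.
case: (boolP (_ && _)) => // /andP[avd ocd]; rewrite ocd andbT.
case: (boolP (avoid _ _ N)) => // /forallPn[i].
rewrite negb_imply negbK => /andP[hi oci].
have hid : d < i + m by rewrite ltnNge; apply: contraL oci => /(avoidP _ _ _ avd).
have hk : d - i \in index_iota 1 m by rewrite mem_index_iota; lia.
rewrite (big_rem _ hk) /= subKn; last by lia.
by rewrite oci (leq_avoid _ avd) //; lia.
Qed.

(** * Probabilities and the two recurrences *)

Local Open Scope ring_scope.

Definition avoid_prob (R : realType) (m : nat) (s : 'S_m) (n : nat) : R :=
  (alpha s n)%:R / n`!%:R.

Definition overlap_prob (R : realType) (m : nat) (s : 'S_m) (k : nat) : R :=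
  #|overlaps s k|%:R / (m + k)`!%:R.

Lemma factR_neq0 (R : realType) (n : nat) : n`!%:R != 0 :> R.
Proof. by rewrite pnatr_eq0 -lt0n fact_gt0. Qed.

Lemma factR_gt0 (R : realType) (n : nat) : 0 < n`!%:R :> R.
Proof. by rewrite ltr0n fact_gt0. Qed.

(** Lets all events of one recurrence be measured in a single symmetric group. *)
Lemma prob_avoid (R : realType) (m n N : nat) (s : 'S_m) : (N <= n)%N ->
  #|[set p : 'S_n | avoid s (word p) N]%SET|%:R / n`!%:R = avoid_prob R s N.
Proof.
move=> /(card_avoid s) h; apply/eqP; rewrite /avoid_prob.
by rewrite eqr_div ?factR_neq0 // -!natrM h mulnC.
Qed.

Lemma prob_avoid_occ (R : realType) (m n d : nat) (s : 'S_m) : (d + m <= n)%N ->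
  #|[set p : 'S_n | avoid s (word p) d && occ s (word p) d]%SET|%:R / n`!%:R =
  avoid_prob R s d / m`!%:R.
Proof.
move=> le_n; rewrite -(prob_avoid R s (leq_trans (leq_addr m d) le_n)).
rewrite -(card_prefix_occ s le_n (@avoid_prefix_only _ _ _ s)) natrM.
by rewrite [RHS]mulrAC mulfK ?factR_neq0.
Qed.

(** Both occurrences lie in one block of length [m + k], whose pattern is independent of the first
    [d] entries. *)
Lemma prob_avoid_occ2 (R : realType) (m n d k : nat) (s : 'S_m) :
  (d + (m + k) <= n)%N ->
  #|[set p : 'S_n | avoid s (word p) d &&
       (occ s (word p) d && occ s (word p) (d + k))]%SET|%:R / n`!%:R =
  avoid_prob R s d * overlap_prob R s k.
Proof.
move=> le_n; rewrite -(prob_avoid R s (leq_trans (leq_addr (m + k) d) le_n)).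
have := card_prefix_pattern
  (E := fun p => occ s (word p) d && occ s (word p) (d + k))
  (F := fun t => occ s (word t) 0 && occ s (word t) k)
  le_n (@avoid_prefix_only _ _ _ s).
rewrite -/(overlaps s k) => h; rewrite /overlap_prob mulrACA -natrM -h.
  by rewrite natrM mulrACA divff ?factR_neq0 // mulr1.
move=> p t o; rewrite -(occ_sub s o) ?leq_addr // addn0.
by rewrite -(occ_sub s o) // addnC.
Qed.

Lemma avoid_probS (R : realType) (m N : nat) (s : 'S_m) : (m <= N.+1)%N ->
  avoid_prob R s N.+1 = avoid_prob R s N -
    #|[set p : 'S_N.+1 | avoid s (word p) N && occ s (word p) (N.+1 - m)]%SET|%:R
    / N.+1`!%:R.
Proof.
move=> le_m; rewrite -(prob_avoid R s (leqnn N.+1)) -(prob_avoid R s (leqnSn N)).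
by rewrite (card_avoidS _ s le_m) natrD mulrDl addrK.
Qed.

(** The subtracted event is enlarged by asking for avoidance only before the last block;
    independence then gives its probability exactly. *)
Lemma avoid_prob_lower (R : realType) (m N : nat) (s : 'S_m) :
  (0 < m <= N.+1)%N ->
  avoid_prob R s N - avoid_prob R s (N.+1 - m) / m`!%:R <= avoid_prob R s N.+1.
Proof.
move=> /andP[m0 le_m]; rewrite avoid_probS // lerD2l lerN2.
rewrite -(@prob_avoid_occ _ _ N.+1); last by lia.
rewrite ler_pM2r ?invr_gt0 ?factR_gt0 // ler_nat.
apply/subset_leq_card/fintype.subsetP => p; rewrite !inE => /andP[h ->].
by rewrite andbT (leq_avoid _ h) //; lia.
Qed.

(** The bound [m + m <= N.+1] makes the truncated difference [N.+1 - m - k] a genuine one for every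
    [k < m]. *)
Lemma avoid_prob_upper (R : realType) (m N : nat) (s : 'S_m) :
  (m + m <= N.+1)%N ->
  avoid_prob R s N.+1 <= avoid_prob R s N - avoid_prob R s (N.+1 - m) / m`!%:R +
    \sum_(1 <= k < m) avoid_prob R s (N.+1 - m - k) * overlap_prob R s k.
Proof.
move=> le_m; rewrite avoid_probS; last by lia.
set d := (N.+1 - m)%N; rewrite -addrA lerD2l lerNl opprD opprK lerBlDr.
rewrite -(@prob_avoid_occ _ _ N.+1); last by rewrite /d; lia.
rewrite (eq_big_nat _ _ (F2 := fun k => #|[set p : 'S_N.+1 |
  avoid s (word p) (d - k) && (occ s (word p) (d - k) && occ s (word p) d)]%SET|%:R
  / N.+1`!%:R)); last first.
  move=> k hk; rewrite -(@prob_avoid_occ2 _ _ N.+1); last by rewrite /d; lia.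
  by rewrite subnK // /d; lia.
rewrite -mulr_suml -mulrDl ler_pM2r ?invr_gt0 ?factR_gt0 //.
rewrite -natr_sum -natrD ler_nat; apply: card_avoid_occ_le; rewrite /d; lia.
Qed.

Lemma avoid_prob_ge0 (R : realType) (m n : nat) (s : 'S_m) : 0 <= avoid_prob R s n.
Proof. by rewrite divr_ge0. Qed.

Lemma avoid_prob_le1 (R : realType) (m n : nat) (s : 'S_m) : avoid_prob R s n <= 1.
Proof.
rewrite ler_pdivrMr ?factR_gt0 // mul1r ler_nat -[X in (_ <= X)%N](card_Sn n) /alpha.
by rewrite -cardsT subset_leq_card // finset.subsetT.
Qed.

Lemma avoid_prob_decr (R : realType) (m n : nat) (s : 'S_m) :
  avoid_prob R s n.+1 <= avoid_prob R s n.
Proof.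
rewrite -(prob_avoid R s (leqnn n.+1)) -(prob_avoid R s (leqnSn n)).
rewrite ler_pM2r ?invr_gt0 ?factR_gt0 // ler_nat.
apply/subset_leq_card/fintype.subsetP => p; rewrite !inE.
exact: leq_avoid.
Qed.

Lemma avoid_prob_short (R : realType) (m n : nat) (s : 'S_m) : (n < m)%N ->
  avoid_prob R s n = 1.
Proof.
move=> lt_nm; rewrite -(prob_avoid R s (leqnn n)).
rewrite [X in #|pred_of_set X|](_ : _ = finset.setT).
  by rewrite cardsT card_Sn divff ?factR_neq0.
by apply/setP => p; rewrite !inE; apply/avoidP => i; lia.
Qed.

(** * Real inequalities: slow decay, geometric sums and factorials *)

Lemma bernoulli_1B (R : realFieldType) (y : R) (i : nat) :
  0 <= y <= 1 -> 1 - i%:R * y <= (1 - y) ^+ i.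
Proof.
move=> /andP[y0 y1]; elim: i => [|i IH]; first by rewrite mul0r subr0 expr0.
rewrite exprSr; apply: (@le_trans _ _ ((1 - i%:R * y) * (1 - y))).
  rewrite -natr1; have : 0 <= i%:R * y * y by rewrite !mulr_ge0.
  lra.
by rewrite ler_wpM2r // subr_ge0.
Qed.

Lemma geometric_decay (R : realFieldType) (a : nat -> R) (r : R) (n i : nat) :
  0 <= r -> (forall j, (j < i)%N -> r * a (n + j)%N <= a (n + j).+1) ->
  r ^+ i * a n <= a (n + i)%N.
Proof.
move=> r0; elim: i => [|i IH] h; first by rewrite expr0 mul1r addn0.
rewrite addnS; apply: le_trans (h i (ltnSn i)); rewrite exprS -mulrA.
by apply: ler_wpM2l => //; apply: IH => j hj; apply: h; apply: ltnW.
Qed.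

(** Strong induction on [(1 - 2 * x) * a n <= a n.+1]: if this ratio holds at earlier indices,
    [m - 1] steps lose at most a factor 2, and the recurrence then yields the ratio at [n]. *)
Lemma slow_decay (R : realFieldType) (a : nat -> R) (m : nat) (x : R) :
  (forall n, 0 <= a n) -> (forall n, (n.+1 < m)%N -> a n.+1 = a n) ->
  (forall n, (m <= n.+1)%N -> a n - a (n.+1 - m)%N * x <= a n.+1) ->
  (0 < m)%N -> 0 <= x -> 8 * m%:R * x <= 1 ->
  forall n i, (i <= m + m)%N -> a n <= 2 * a (n + i)%N.
Proof.
move=> a0 ashort alow m0 x0 hx.
have m1 : 1 <= m%:R :> R by rewrite ler1n.
have xm : x <= m%:R * x by rewrite ler_peMl.
(* By Bernoulli the power is at least [1 - 4 * m * x], hence the constant 8 in the hypothesis on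
   [x]. *)
have half i : (i <= m + m)%N -> 1 / 2 <= (1 - 2 * x) ^+ i.
  move=> hi; apply: le_trans (bernoulli_1B _ _); last by apply/andP; split; lra.
  have : i%:R * x <= (m + m)%:R * x by rewrite ler_wpM2r // ler_nat.
  by rewrite natrD; lra.
have conclude n i : (i <= m + m)%N ->
    (forall j, (j < i)%N -> (1 - 2 * x) * a (n + j)%N <= a (n + j).+1) ->
    a n <= 2 * a (n + i)%N.
  move=> hi h; have r0 : 0 <= 1 - 2 * x by lra.
  have := geometric_decay r0 h.
  have : 1 / 2 * a n <= (1 - 2 * x) ^+ i * a n by rewrite ler_wpM2r // half.
  lra.
suff step n : (1 - 2 * x) * a n <= a n.+1 by move=> n i hi; apply: conclude.
elim/ltn_ind: n => n IH; have xan : 0 <= x * a n by rewrite mulr_ge0.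
have [nm|nm] := ltnP n.+1 m; first by rewrite ashort //; lra.
have ad : a (n.+1 - m)%N <= 2 * a n.
  have {2}-> : n = (n.+1 - m + m.-1)%N by lia.
  by apply: conclude => [|j hj]; [|apply: IH]; lia.
have : a (n.+1 - m)%N * x <= 2 * a n * x by rewrite ler_wpM2r.
by have := alow n nm; lra.
Qed.

Lemma sum_geometric_le (R : realFieldType) (y : R) (m : nat) :
  0 <= y <= 1 / 2 -> (2 <= m)%N -> \sum_(2 <= k < m) y ^+ k <= 2 * y ^+ 2.
Proof.
move=> /andP[y0 y2] le_m.
(* The subtracted tail [2 * y ^+ m] makes the bound inductive in the upper end. *)
suff : \sum_(2 <= k < m) y ^+ k <= 2 * y ^+ 2 - 2 * y ^+ m.
  by have := exprn_ge0 m y0; lra.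
rewrite -(subnKC le_m); elim: (m - 2)%N => [|j IH].
  by rewrite addn0 big_geq // subrr.
rewrite addnS big_nat_recr /=; last by lia.
have : y * y ^+ (2 + j) <= 1 / 2 * y ^+ (2 + j) by rewrite ler_wpM2r // exprn_ge0.
by rewrite (exprS y (2 + j)); lra.
Qed.

Lemma fact_addn_ge (m k : nat) : (m`! * m.+1 ^ k <= (m + k)`!)%N.
Proof.
elim: k => [|k IH]; first by rewrite addn0 muln1.
rewrite addnS factS expnS mulnCA; apply: leq_mul => //.
by rewrite ltnS leq_addr.
Qed.

(** * From a geometric bound to the limit of the roots *)

(** The constant disappears because the [n]-th root of [c] tends to 1. *)
Lemma limn_root_le (R : realType) (a : nat -> R) (c l : R) (N : nat) :
  0 < c -> 0 < l -> (forall n, 0 <= a n) ->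
  (forall n, (N <= n)%N -> a n <= c * l ^+ n) ->
  limn (fun n => a n `^ (n%:R^-1)) <= l.
Proof.
move=> c0 l0 a0 ale.
have [cv|dv] := pselect (cvgn (fun n => a n `^ (n%:R^-1))); last first.
  (* On a divergent sequence the junk value of [limn] is 0. *)
  by rewrite dvgP // ltW.
have gl : ((fun n => c `^ (n%:R^-1) * l) @ \oo --> l)%classic.
  rewrite -[X in (_ --> X)%classic]mul1r; apply: cvgMl.
  have -> : (fun n : nat => c `^ n%:R^-1) = expR \o (fun n => n%:R^-1 * ln c).
    by apply/funext => n; rewrite /powR gt_eqF.
  rewrite -[X in (_ --> X)%classic]expR0; apply: continuous_cvg.
    exact: continuous_expR.
  rewrite -[X in (_ --> X)%classic](mul0r (ln c)); apply: cvgMl.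
  (* The harmonic sequence starts at index 0 with the inverse of 1, hence the shift. *)
  by rewrite -cvg_shiftS; apply: cvg_harmonic.
rewrite -(cvg_lim _ gl) //; apply: ler_lim => //; first by apply/cvg_ex; exists l.
have [c0' l0'] := (ltW c0, ltW l0).
near=> n.
have n0 : (0 < n)%N by near: n; exists 1%N.
apply: (@le_trans _ _ ((c * l ^+ n) `^ n%:R^-1)).
  apply: ge0_ler_powR; rewrite ?nnegrE ?invr_ge0 ?mulr_ge0 ?exprn_ge0 //.
  by apply: ale; near: n; exists N.
rewrite powRM ?exprn_ge0 // -powR_mulrn // -powRrM mulfV ?powRr1 //.
by rewrite pnatr_eq0 -lt0n.
Unshelve. all: by end_near.
Qed.

(** * The overlap sum and the conclusion *)

(** The term at 1 vanishes and the others are at most [y ^+ k] over the factorial of [m], with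
    [y = 4 / (m + 1)]. From [7 <= m] follows [y <= 1 / 2], so the geometric sum is at most
    [2 * y ^+ 2], which produces 32. *)
Lemma sum_overlap_prob (R : realType) (m : nat) (s : 'S_m) : (7 <= m)%N ->
  s \notin [set incr_pattern m; decr_pattern m]%SET ->
  \sum_(1 <= k < m) overlap_prob R s k <= 32 / (m%:R ^+ 2 * m`!%:R).
Proof.
move=> m7 nmono; have m0 : 0 < m%:R :> R by rewrite ltr0n; lia.
have m1 : 8 <= m.+1%:R :> R by rewrite ler_nat.
pose y : R := 4 / m.+1%:R.
have y0 : 0 <= y by rewrite divr_ge0.
have y12 : y <= 1 / 2 by rewrite /y ler_pdivrMr; lra.
have term k : (k <= m)%N -> overlap_prob R s k <= y ^+ k / m`!%:R.
  move=> hk; rewrite /overlap_prob /y expr_div_n -mulrA -invfM.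
  apply: ler_pM; rewrite ?invr_ge0 //.
    by rewrite -natrX ler_nat card_overlaps.
  rewrite lef_pV2 ?posrE ?factR_gt0 ?mulr_gt0 ?factR_gt0 ?exprn_gt0 //.
  by rewrite -natrX -natrM ler_nat mulnC fact_addn_ge.
rewrite big_ltn ?[overlap_prob _ _ 1]/overlap_prob ?overlaps1 ?mul0r ?add0r //;
  last by lia.
apply: (@le_trans _ _ (\sum_(2 <= k < m) y ^+ k / m`!%:R)).
  by rewrite ler_sum_nat // => k hk; apply: term; lia.
rewrite -mulr_suml invfM mulrA ler_pM2r ?invr_gt0 ?factR_gt0 //.
apply: le_trans (sum_geometric_le _ _) _; rewrite ?y0 //; first by lia.
rewrite /y expr_div_n mulrA (_ : 2 * 4 ^+ 2 = 32); last by ring.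
rewrite ler_pM2l // lef_pV2 ?posrE ?exprn_gt0 //.
by rewrite ler_pXn2r ?nnegrE ?ler_nat // ltW.
Qed.

Theorem theorem1 (R : realType) :
  exists (C : R) (m0 : nat), 0 < C /\
    forall (m : nat) (s : 'S_m), (m0 <= m)%N ->
      s \notin [set incr_pattern m; decr_pattern m]%SET ->
      rho R s <= 1 - 1 / m`!%:R + C / (m%:R ^+ 2 * m`!%:R).
Proof.
(* 64 is the overlap constant 32 times the factor 2 of [slow_decay]. From [9 <= m], the factorial of
   [m - 1] is at least 8, as [hx] requires. *)
exists 64, 9%N; split=> // m s m9 nmono.
set l := _ + _; pose a := avoid_prob R s; pose x : R := m`!%:R^-1.
have x0 : 0 < x by rewrite invr_gt0 factR_gt0.
have hx : 8 * m%:R * x <= 1.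
  rewrite ler_pdivrMr ?factR_gt0 // mul1r -natrM ler_nat.
  have -> : m = m.-1.+1 by lia.
  by rewrite factS mulnC leq_mul2l /= (leq_trans _ (fact_geq _)) //; lia.
have m1 : 9 <= m%:R :> R by rewrite ler_nat.
have c0 : 0 < 64 / (m%:R ^+ 2 * m`!%:R) :> R.
  by rewrite divr_gt0 // mulr_gt0 ?factR_gt0 // exprn_gt0 //; lra.
have x1 : x < 1 by have : 9 * x <= m%:R * x; [rewrite ler_wpM2r //|]; lra.
have l0 : 0 < l by rewrite /l mul1r -/x; lra.
have a0 n : 0 <= a n by exact: avoid_prob_ge0.
have adecr i n : a (n + i)%N <= a n.
  elim: i => [|i IH]; first by rewrite addn0.
  by rewrite addnS (le_trans _ IH) ?avoid_prob_decr.
have double n i : (i <= m + m)%N -> a n <= 2 * a (n + i)%N.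
  apply: (@slow_decay _ a m x) => //; try lia; try lra.
    by move=> k hk; rewrite /a !avoid_prob_short //; lia.
  by move=> k hk; apply: avoid_prob_lower; lia.
have step N : (m + m <= N.+1)%N -> a N.+1 <= l * a N.
  move=> hN; apply: le_trans (avoid_prob_upper R s hN) _; rewrite -/a -/x.
  have main : a N * x <= a (N.+1 - m)%N * x.
    rewrite (ler_wpM2r (ltW x0)) //.
    by rewrite {1}(_ : N = (N.+1 - m) + m.-1)%N ?adecr //; lia.
  (* The indices differ by [m - 1 + k], at most [2 * m], so [double] applies to every term. *)
  have err : \sum_(1 <= k < m) a (N.+1 - m - k)%N * overlap_prob R s k <=
      2 * a N * (32 / (m%:R ^+ 2 * m`!%:R)).
    apply: le_trans (_ : _ <= \sum_(1 <= k < m) 2 * a N * overlap_prob R s k) _.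
      apply: ler_sum_nat => k hk; rewrite ler_wpM2r ?divr_ge0 //.
      by rewrite {2}(_ : N = N.+1 - m - k + (m.-1 + k))%N ?double //; lia.
    by rewrite -mulr_sumr ler_wpM2l ?mulr_ge0 // sum_overlap_prob //; lia.
  rewrite /l mul1r -/x; lra.
have l0' := ltW l0.
(* This constant makes the bound equal to 1 at index [m + m], where [step] takes over. *)
apply: (@limn_root_le _ a (l ^- (m + m)) l (m + m)) => //.
  by rewrite invr_gt0 exprn_gt0.
move=> n /subnKC <-; rewrite (exprD l (m + m)) mulKf ?expf_neq0 ?gt_eqF //.
elim: (n - _)%N => [|i IH]; first by rewrite addn0 expr0 avoid_prob_le1.
rewrite addnS exprS (le_trans (step _ _)) ?ler_wpM2l //; lia.
Qed.
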